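(* Let $(\alpha,\eta)$ be a contact pair of type $(h,k)$ on a $(2h+2k+2)$-dimensional smooth manifold $M$. Then there exists a unique vector field $X_\alpha$ on $M$ satisfying $$\alpha(X_\alpha)=1,\qquad i(X_\alpha)\bigl(d\alpha^{h}\wedge\eta\wedge d\eta^{k}\bigr)=0,$$ and a unique vector field $X_\eta$ on $M$ satisfying $$\eta(X_\eta)=1,\qquad i(X_\eta)\bigl(\alpha\wedge d\alpha^{h}\wedge d\eta^{k}\bigr)=0.$$
   Context: All objects are $C^\infty$. A contact pair of type $(h,k)$ (with $h,k\ge 0$ integers) on a $(2h+2k+2)$-dimensional manifold $M$ is a pair $(\alpha,\eta)$ of 1-forms (Pfaffian forms) on $M$ such that $d\alpha^{h+1}=0$, $d\eta^{k+1}=0$, and $\alpha\wedge d\alpha^{h}\wedge\eta\wedge d\eta^{k}$ is a volume form on $M$ (nowhere zero). Here $d\alpha^{j}$ denotes the $j$-th exterior power $(d\alpha)^{j}$, and $i(X)$ denotes interior product with $X$. *)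

(* Defs.v *)
From HB Require Import structures.
From mathcomp Require Import all_boot all_order all_fingroup all_algebra.
From mathcomp Require Import boolp classical_sets functions reals.
From mathcomp Require Import topology normedtype derive.

Set Implicit Arguments.
Unset Strict Implicit.
Unset Printing Implicit Defensive.

Import Order.TTheory GRing.Theory Num.Theory.
Import numFieldNormedType.Exports.

Local Open Scope classical_set_scope.
Local Open Scope ring_scope.

(* [U] is meant to be open: values of [f] outside [U] are then irrelevant. *)
Fixpoint Ck_on (R : realType) (n : nat) (W : normedModType R) (k : nat)
    (U : set 'rV[R]_n) (f : 'rV[R]_n -> W) : Prop :=
  match k with
  | 0 => forall x, U x -> {for x, continuous f}
  | k'.+1 => (forall x, U x -> differentiable f x) /\
             (forall v, Ck_on k' U ('D_v f))
  end.

Definition smooth_on (R : realType) (n : nat) (W : normedModType R)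
    (U : set 'rV[R]_n) (f : 'rV[R]_n -> W) : Prop :=
  forall k, Ck_on k U f.

(* [chart_map] and [chart_inv] are total functions that are only meaningful
   on [chart_dom] and on its image. *)
Record chart (R : realType) (n : nat) (M : topologicalType) := Chart {
  chart_dom : set M;
  chart_map :> M -> 'rV[R]_n;
  chart_inv : 'rV[R]_n -> M;
  chart_dom_open : open chart_dom;
  chart_img_open : open (chart_map @` chart_dom);
  chart_mapK : forall p, chart_dom p -> chart_inv (chart_map p) = p;
  chart_map_cont : {within chart_dom, continuous chart_map};
  chart_inv_cont : {within chart_map @` chart_dom, continuous chart_inv}
}.

Definition chart_img (R : realType) n (M : topologicalType) (c : chart R n M) :
  set 'rV[R]_n := c @` chart_dom c.

Definition transition (R : realType) n (M : topologicalType)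
  (c c' : chart R n M) : 'rV[R]_n -> 'rV[R]_n := c' \o chart_inv c.

(* The smooth structure is given by an atlas, not required to be maximal. *)
Record smooth_manifold (R : realType) (n : nat) := SmoothManifold {
  carrier :> topologicalType;
  manifold_hausdorff : hausdorff_space carrier;
  manifold_second_countable : @second_countable carrier;
  atlas_index : Type;
  atlas : atlas_index -> chart R n carrier;
  atlas_cover : forall p : carrier, exists i, chart_dom (atlas i) p;
  atlas_compat : forall i j,
    smooth_on (atlas i @` (chart_dom (atlas i) `&` chart_dom (atlas j)))
              (transition (atlas i) (atlas j))
}.

(* A tangent vector at [p] is a family of coordinate vectors, one for each
   chart around [p], related by the differentials of the transition maps; the
   family is extended by 0 to the charts whose domain misses [p]. *)
Section TangentSpace.
Context (R : realType) (n : nat) (M : smooth_manifold R n) (p : M).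

Definition tangent_pred : {pred (atlas_index M -> 'rV[R]_n)} := fun v =>
  `[< (forall i, ~ chart_dom (atlas i) p -> v i = 0) /\
      (forall i j, chart_dom (atlas i) p -> chart_dom (atlas j) p ->
         v j = 'd (transition (atlas i) (atlas j)) (atlas i p) (v i)) >].

Lemma tangent_submod_closed : submod_closed tangent_pred.
Proof.
split=> [|a u v /asboolP[u0 uE] /asboolP[v0 vE]]; apply/asboolP; split=> //=.
- by move=> i j _ _; rewrite linear0.
- by move=> i ip; rewrite /= !fctE u0// v0// scaler0 addr0.
- by move=> i j ip jp; rewrite !fctE (uE i j)// (vE i j)// linearP.
Qed.

HB.instance Definition _ :=
  GRing.isSubmodClosed.Build R (atlas_index M -> 'rV[R]_n) tangent_pred
    tangent_submod_closed.

Record tangent := Tangent {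
  tangent_val :> atlas_index M -> 'rV[R]_n;
  tangent_valP : tangent_val \in tangent_pred
}.

HB.instance Definition _ := [isSub for tangent_val].
HB.instance Definition _ := [Choice of tangent by <:].
HB.instance Definition _ := [SubChoice_isSubLmodule of tangent by <:].

End TangentSpace.

Lemma diff_near_comp (R : realType) (U V W : normedModType R)
    (f : U -> W) (g : V -> W) (h : U -> V) (a : U) (b : V) (w : U) :
  h a = b -> differentiable f a -> differentiable h a -> differentiable g b ->
  (\near a, f a = g (h a)) -> 'd f a w = 'd g b ('d h a w).
Proof.
move=> <- df dh dg fgh.
have dgh : differentiable (g \o h) a by exact: differentiable_comp.
rewrite -deriveE// (near_eq_derive w (g := g \o h))// deriveE//.
by rewrite diff_comp.
Qed.

Section CoordinateVectors.
Context (R : realType) (n : nat) (M : smooth_manifold R n).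

Lemma transition_differentiable (i j : atlas_index M) (p : M) :
  chart_dom (atlas i) p -> chart_dom (atlas j) p ->
  differentiable (transition (atlas i) (atlas j)) (atlas i p).
Proof.
move=> ip jp; have [+ _] := @atlas_compat R n M i j 1%N; apply.
by exists p.
Qed.

Lemma transition_cocycle (i j k : atlas_index M) (p : M) (w : 'rV[R]_n) :
  chart_dom (atlas i) p -> chart_dom (atlas j) p -> chart_dom (atlas k) p ->
  'd (transition (atlas i) (atlas k)) (atlas i p) w =
  'd (transition (atlas j) (atlas k)) (atlas j p)
    ('d (transition (atlas i) (atlas j)) (atlas i p) w).
Proof.
move=> ip jp kp.
apply: diff_near_comp.
- by rewrite /transition /= chart_mapK.
- exact: transition_differentiable.
- exact: transition_differentiable.
- exact: transition_differentiable.
have imgp : (atlas i @` chart_dom (atlas i)) (atlas i p) by exists p.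
have ci : {for atlas i p, continuous (chart_inv (atlas i))}.
  have := chart_inv_cont (c := atlas i).
  rewrite continuous_open_subspace; last exact: chart_img_open.
  by apply; rewrite inE.
have : nbhs (chart_inv (atlas i) (atlas i p)) (chart_dom (atlas j)).
  rewrite chart_mapK//; apply: open_nbhs_nbhs; split => //.
  exact: chart_dom_open.
move=> /ci cj.
have {}cj : \forall y \near nbhs (atlas i p),
  chart_dom (atlas j) (chart_inv (atlas i) y) by exact: cj.
near=> y; rewrite /transition /= chart_mapK//.
by near: y.
Unshelve. all: by end_near.
Qed.

Definition coord_family (i : atlas_index M) (p : M) (w : 'rV[R]_n) :
    atlas_index M -> 'rV[R]_n :=
  fun j => if `[< chart_dom (atlas i) p /\ chart_dom (atlas j) p >]
           then 'd (transition (atlas i) (atlas j)) (atlas i p) w else 0.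

Lemma coord_family_tangent i p w : coord_family i p w \in tangent_pred p.
Proof.
apply/asboolP; rewrite /coord_family; split=> [j jp|j k jp kp].
  by case: asboolP => // -[].
have [ip|ip] := pselect (chart_dom (atlas i) p); last first.
  by do 2 (case: asboolP => [[]//|_]); rewrite linear0.
do 2 (case: asboolP => [_|/not_andP[]//]).
exact: transition_cocycle.
Qed.

(* The vector at [p] with coordinates [w] in the chart [i], i.e.
   [\sum_a w_a d/dx^a]; it is 0 when [p] is not in the domain of that chart. *)
Definition coord_vector (i : atlas_index M) (p : M) (w : 'rV[R]_n) : tangent p :=
  Tangent (coord_family_tangent i p w).

End CoordinateVectors.

Record vector_field (R : realType) n (M : smooth_manifold R n) := VectorField {
  vector_at :> forall p : M, tangent p;
  vector_smooth : forall i : atlas_index M,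
    smooth_on (chart_img (atlas i))
      (fun y => vector_at (chart_inv (atlas i) y) i)
}.

Record one_form (R : realType) n (M : smooth_manifold R n) := OneForm {
  covector_at :> forall p : M, {scalar (tangent p)};
  covector_smooth : forall (i : atlas_index M) (w : 'rV[R]_n),
    smooth_on (chart_img (atlas i))
      (fun y => covector_at (chart_inv (atlas i) y)
                  (coord_vector i (chart_inv (atlas i) y) w) : R^o)
}.

(* Alternating [k]-linear forms on [V], as functions of [k] vectors.
   Multilinearity and antisymmetry are not recorded in the type: they hold for
   the forms below, all built from smooth 1-forms by [dform], [wedge] and
   [interior]. *)
Definition kform (R : realType) (V : lmodType R) (k : nat) : Type :=
  ('I_k -> V) -> R.

Section ExteriorAlgebra.
Context (R : realType) (V : lmodType R).
Implicit Types (k l : nat).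

Definition wedge k l (w : kform V k) (t : kform V l) : kform V (k + l) :=
  fun v => (k`! * l`!)%:R^-1 *
    \sum_(s : 'S_(k + l))
      (-1) ^+ s * w (fun a => v (s (lshift l a)))
                * t (fun b => v (s (rshift k b))).

Fixpoint wedge_pow k (w : kform V k) (m : nat) : kform V (m * k) :=
  match m return kform V (m * k) with
  | 0 => fun=> 1
  | m'.+1 => wedge w (@wedge_pow k w m')
  end.

Definition interior (x : V) k : kform V k -> kform V k.-1 :=
  match k return kform V k -> kform V k.-1 with
  | 0 => fun _ _ => 0
  | k'.+1 => fun w v => w (fun a => oapp v x (unlift ord0 a))
  end.

Definition kform_of_scalar (f : {scalar V}) : kform V 1 := fun v => f (v ord0).

End ExteriorAlgebra.

Arguments wedge_pow {R V k} w m _.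

Section DifferentialForms.
Context (R : realType) (n : nat) (M : smooth_manifold R n).

Definition form (k : nat) : Type := forall p : M, kform (tangent p) k.

Definition form_of (alpha : one_form M) : form 1 :=
  fun p => kform_of_scalar (alpha p).

Definition wedgef k l (w : form k) (t : form l) : form (k + l) :=
  fun p => wedge (w p) (t p).

Definition wedgef_pow k (w : form k) (m : nat) : form (m * k) :=
  fun p => wedge_pow (w p) m.

Definition interiorf (X : vector_field M) k (w : form k) : form k.-1 :=
  fun p => interior (X p) (w p).

Definition chart_at (p : M) : atlas_index M := projT1 (cid (atlas_cover p)).

(* [d alpha (u, v) = u (alpha v~) - v (alpha u~)], with [u~] and [v~] the
   extensions of [u] and [v] having constant coordinates in a chart around [p],
   that is [\sum_(a, b) (d_a alpha_b - d_b alpha_a) u_a v_b]; by symmetry of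
   second derivatives the choice of the chart is immaterial. *)
Definition dform (alpha : one_form M) : form 2 := fun p v =>
  let i := chart_at p in
  let c := atlas i in
  let alphac (w y : 'rV[R]_n) : R^o :=
    alpha (chart_inv c y) (coord_vector i (chart_inv c y) w) in
  let u0 := v ord0 i in
  let u1 := v ord_max i in
  'D_u0 (alphac u1) (c p) - 'D_u1 (alphac u0) (c p).

Definition vanishes k (w : form k) : Prop := forall p v, w p v = 0.

Definition nowhere_zero k (w : form k) : Prop := forall p, exists v, w p v != 0.

End DifferentialForms.

Arguments wedgef_pow {R n M k} w m p _.

Notation "w \wedge t" := (wedgef w t) (at level 40, left associativity).

Definition contact_pair (R : realType) (h k : nat)
    (M : smooth_manifold R (2 * h + 2 * k + 2)) (alpha eta : one_form M) : Prop :=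
  [/\ vanishes (wedgef_pow (dform alpha) h.+1),
      vanishes (wedgef_pow (dform eta) k.+1) &
      nowhere_zero (form_of alpha \wedge wedgef_pow (dform alpha) h
                    \wedge form_of eta \wedge wedgef_pow (dform eta) k)].
Arguments contact_pair {R} h k {M} alpha eta.

(* Main.v *)
Require Import Defs.
From HB Require Import structures.
From mathcomp Require Import all_boot all_order all_fingroup all_algebra.
From mathcomp Require Import boolp classical_sets functions reals.
From mathcomp Require Import topology normedtype landau derive.
From mathcomp Require Import zify ring lra.

Set Implicit Arguments.
Unset Strict Implicit.
Unset Printing Implicit Defensive.

Import Order.TTheory GRing.Theory Num.Theory.
Import numFieldNormedType.Exports.

Local Open Scope classical_set_scope.
Local Open Scope ring_scope.

(** Why the theorem holds.

    Fix one of the two cases: [a] is the form to be normalised ([alpha] or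
    [eta]) and [w] is the wedge product of the other factors.  If the manifold
    has dimension [n], then [w] has degree [n - 1], and a wedge product does not
    depend, up to a nonzero constant and a renumbering of its arguments, on how
    its factors are ordered and bracketed; so [a \wedge w] is again nowhere zero
    ([nonzero_wedgeA], [nonzero_wedgeCA]).
    At a point [p], a nonzero top-degree form [vol = a /\ w] makes the
    contraction [x |-> i(x) vol] an isomorphism from vectors to forms of degree
    [n - 1]: injective because replacing the [b]-th basis vector by [x] in
    [vol e] gives [x_b vol e], surjective because a form of degree [n - 1] is
    determined by its values on the families obtained from the basis by
    omitting one vector.  Hence [w = i(x) vol] for an explicit [x]
    ([kernel_vector]), and [i(x) w = 0] as [vol] is alternating.  Conversely a
    vector [y] with [a y = 0] and [i(y) w = 0] contracts [vol] to zero, since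
    every term of the wedge product puts [y] into [a] or into [w], so [y = 0]
    ([kills_eq0]).  Thus [a x] is nonzero, [x / a x] is a solution, and the
    difference of two solutions vanishes.

    The solution at [p] is unique, so it may be computed in any chart around
    [p], by a formula rational in the coefficients of [a] and [w].  Smoothness of
    the field therefore reduces to smoothness of these coefficients in a fixed
    chart [i] ([reeb_smooth]).  The delicate one is [d a]: [dform] evaluates it
    at [p] in a chart chosen at [p], with no regularity in [p].  That every chart
    around [p] gives the same value ([dform_in_chart]) follows from the chain
    rule for the transition map, where the terms with second derivatives cancel
    by the symmetry of mixed partial derivatives ([derive_comm]), proved from
    the mean value theorem. *)

(** * Permutations and antisymmetrization over finite index types *)

Section PermutationTransport.
Context (J I : finType) (f : J -> I).

(** An injection [f] transports a permutation of [J] to one of [I] that fixes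
    everything outside the image of [f]. *)
Definition ext_fun (s : {perm J}) (i : I) : I :=
  if [pick j | f j == i] is Some j then f (s j) else i.

Hypothesis f_inj : injective f.

Lemma ext_funE s j : ext_fun s (f j) = f (s j).
Proof.
rewrite /ext_fun; case: pickP => [j' /eqP/f_inj->//|/(_ j)].
by rewrite eqxx.
Qed.

Lemma ext_fun_out s i : i \notin codom f -> ext_fun s i = i.
Proof.
rewrite /ext_fun; case: pickP => // j /eqP <-.
by rewrite codom_f.
Qed.

Lemma ext_funK s : cancel (ext_fun s) (ext_fun s^-1).
Proof.
move=> i; have [/codomP[j ->]|ni] := boolP (i \in codom f).
  by rewrite !ext_funE permK.
by rewrite !ext_fun_out.
Qed.

Definition ext_perm (s : {perm J}) : {perm I} := perm (can_inj (ext_funK s)).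

Lemma ext_permE s j : ext_perm s (f j) = f (s j).
Proof. by rewrite permE ext_funE. Qed.

Lemma ext_perm_out s i : i \notin codom f -> ext_perm s i = i.
Proof. by move=> ni; rewrite permE ext_fun_out. Qed.

Lemma ext_permM s t : ext_perm (s * t)%g = (ext_perm s * ext_perm t)%g.
Proof.
apply/permP => i; rewrite permM.
have [/codomP[j ->]|ni] := boolP (i \in codom f).
  by rewrite !ext_permE permM.
by rewrite !ext_perm_out.
Qed.

Lemma ext_tperm x y : ext_perm (tperm x y) = tperm (f x) (f y).
Proof.
apply/permP => i; have [/codomP[j ->]|ni] := boolP (i \in codom f).
  by rewrite ext_permE -inj_tperm.
rewrite ext_perm_out//; apply/esym/tpermD; apply: contraNneq ni => <-;
  exact: codom_f.
Qed.

(** The parity can be read off a product of transpositions, and transport is a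
    morphism that maps transpositions to transpositions. *)
Lemma odd_ext_perm s : odd_perm (ext_perm s) = odd_perm s.
Proof.
have ext1 : ext_perm 1 = 1%g.
  by apply: (mulgI (ext_perm 1)); rewrite -ext_permM !mulg1.
have [ts -> /allP dts] := prod_tpermP s.
elim: ts dts => [_|t ts IH dts]; first by rewrite !big_nil ext1 !odd_perm1.
rewrite !big_cons ext_permM !odd_permM IH; last first.
  by move=> u uts; apply: dts; rewrite inE uts orbT.
by rewrite ext_tperm !odd_tperm (inj_eq f_inj).
Qed.

End PermutationTransport.

Section Antisymmetrization.
Context (R : realType) (V : Type).

Definition antisymmetrize (I : finType) (f : (I -> V) -> R) (v : I -> V) : R :=
  \sum_(s : {perm I}) (-1) ^+ s * f (fun i => v (s i)).

Lemma antisymmetrize_perm (I : finType) f (v : I -> V) (t : {perm I}) :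
  antisymmetrize f (fun i => v (t i)) = (-1) ^+ t * antisymmetrize f v.
Proof.
rewrite /antisymmetrize mulr_sumr (reindex_inj (mulIg t^-1)%g).
apply: eq_bigr => s _; rewrite odd_permM odd_permV signr_addb [_ * (-1) ^+ t]mulrC -mulrA.
by congr (_ * (_ * f _)); apply/funext => i; rewrite permM permKV.
Qed.

(** Antisymmetrizing a block of arguments before antisymmetrizing all of them
    only multiplies the result by the number of permutations of the block: each
    of these permutations, transported to [I], is absorbed by the outer sum. *)
Lemma antisymmetrize_absorb (J I : finType) (b : J -> I) (b_inj : injective b)
    (w : (J -> V) -> R) (g : (I -> V) -> R) (v : I -> V) :
  (forall u u', (forall i, i \notin codom b -> u i = u' i) -> g u = g u') ->
  antisymmetrize (fun u => antisymmetrize w (u \o b) * g u) v =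
  #|{perm J}|%:R * antisymmetrize (fun u => w (u \o b) * g u) v.
Proof.
move=> gE; rewrite {1}/antisymmetrize.
transitivity (\sum_(s : {perm I}) \sum_(t : {perm J})
    (-1) ^+ (ext_perm b_inj t * s)%g *
    (w ((fun i => v ((ext_perm b_inj t * s)%g i)) \o b) *
     g (fun i => v ((ext_perm b_inj t * s)%g i)))).
  apply: eq_bigr => s _; rewrite mulr_suml mulr_sumr; apply: eq_bigr => t _.
  rewrite odd_permM odd_ext_perm signr_addb.
  rewrite (gE (fun i => v ((ext_perm b_inj t * s)%g i)) (fun i => v (s i))); last first.
    by move=> i ni; rewrite permM ext_perm_out.
  have -> : (fun i => v ((ext_perm b_inj t * s)%g i)) \o b =
      fun j => v (s (b (t j))).
    by apply/funext => j /=; rewrite permM ext_permE.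
  by rewrite !mulrA [(-1) ^+ t * _]mulrC.
rewrite exchange_big /= mulr_natl -sumr_const; apply: eq_bigr => t _.
by rewrite /antisymmetrize [RHS](reindex_inj (mulgI (ext_perm b_inj t))).
Qed.

(** Renumbering the arguments introduces no sign, because conjugating by a
    bijection preserves parities.  This is what makes
    wedge products with differently bracketed degrees comparable. *)
Lemma antisymmetrize_reindex (I I' : finType) (b : I -> I') (b_bij : bijective b)
    (f : (I -> V) -> R) (v : I' -> V) :
  antisymmetrize (fun u => f (u \o b)) v = antisymmetrize f (v \o b).
Proof.
have b_inj := bij_inj b_bij; have [c bK cK] := b_bij.
have c_inj := can_inj cK.
have extK t : ext_perm b_inj (ext_perm c_inj t) = t.
  by apply/permP => i; rewrite -(cK i) !ext_permE !cK.
have extK' t : ext_perm c_inj (ext_perm b_inj t) = t.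
  by apply/permP => i; rewrite -(bK i) !ext_permE !bK.
rewrite /antisymmetrize (reindex (ext_perm b_inj)) /=; last first.
  by exists (ext_perm c_inj) => t _; [exact: extK' | exact: extK].
apply: eq_bigr => s _; rewrite odd_ext_perm; congr (_ * f _).
by apply/funext => i /=; rewrite ext_permE.
Qed.

End Antisymmetrization.

(** * Wedge products as antisymmetrized tensor products *)

Section KForms.
Context (R : realType) (V : lmodType R).
Implicit Types (k l : nat).

Definition tensor k l (w : kform V k) (t : kform V l) : kform V (k + l) :=
  fun v => w (v \o @lshift k l) * t (v \o @rshift k l).

(** Comparison up to a nonzero factor is enough for the question whether a
    wedge product vanishes, and avoids computing products of factorials. *)
Definition is_antisymmetrization k (w f : kform V k) : Prop :=
  exists2 c, c != 0 & forall v, w v = c * antisymmetrize f v.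

Definition nonzero_form k (w : kform V k) : Prop := exists v, w v != 0.

Lemma antisymmetrizeZ (I : finType) c (f : (I -> V) -> R) v :
  antisymmetrize (fun u => c * f u) v = c * antisymmetrize f v.
Proof. by rewrite /antisymmetrize mulr_sumr; apply: eq_bigr => s _; rewrite mulrCA. Qed.

Lemma wedgeE k l (w : kform V k) (t : kform V l) v :
  wedge w t v = (k`! * l`!)%:R^-1 * antisymmetrize (tensor w t) v.
Proof. by congr (_ * _); apply: eq_bigr => s _; rewrite -mulrA. Qed.

Lemma wedge_coef_neq0 k l : (k`! * l`!)%:R^-1 != 0 :> R.
Proof. by rewrite invr_eq0 pnatr_eq0 -lt0n muln_gt0 !fact_gt0. Qed.

Lemma card_perm_neq0 (J : finType) : #|{perm J}|%:R != 0 :> R.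
Proof. by rewrite pnatr_eq0 -lt0n; apply/card_gt0P; exists 1%g. Qed.

Lemma antisym_wedge k l (w : kform V k) (t : kform V l) :
  is_antisymmetrization (wedge w t) (tensor w t).
Proof. by exists (k`! * l`!)%:R^-1; [exact: wedge_coef_neq0|exact: wedgeE]. Qed.

Lemma antisym_wedgel k l (w f : kform V k) (t : kform V l) :
  is_antisymmetrization w f -> is_antisymmetrization (wedge w t) (tensor f t).
Proof.
move=> [c c0 wE]; exists ((k`! * l`!)%:R^-1 * c * #|{perm 'I_k}|%:R).
  by rewrite !mulf_neq0 ?wedge_coef_neq0 ?card_perm_neq0.
move=> v; rewrite wedgeE -!mulrA; congr (_ * _).
rewrite /tensor -(antisymmetrize_absorb (@lshift_inj k l)); last first.
  move=> u u' uE; congr (t _); apply/funext => j; apply: uE.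
  by apply/codomP => -[i /eqP]; rewrite eq_rlshift.
by rewrite -antisymmetrizeZ; congr antisymmetrize; apply/funext => u; rewrite wE mulrA.
Qed.

Lemma antisym_wedger k l (w : kform V k) (t f : kform V l) :
  is_antisymmetrization t f -> is_antisymmetrization (wedge w t) (tensor w f).
Proof.
move=> [c c0 tE]; exists ((k`! * l`!)%:R^-1 * c * #|{perm 'I_l}|%:R).
  by rewrite !mulf_neq0 ?wedge_coef_neq0 ?card_perm_neq0.
move=> v; rewrite wedgeE -!mulrA; congr (_ * _).
have -> : tensor w f = fun u => f (u \o @rshift k l) * w (u \o @lshift k l).
  by apply/funext => u; rewrite /tensor mulrC.
rewrite -(antisymmetrize_absorb (@rshift_inj k l)); last first.
  move=> u u' uE; congr (w _); apply/funext => j; apply: uE.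
  by apply/codomP => -[i /eqP]; rewrite eq_lrshift.
rewrite -antisymmetrizeZ; congr antisymmetrize; apply/funext => u.
by rewrite /tensor tE mulrC mulrA.
Qed.

Lemma nonzero_reindex k k' (b : 'I_k -> 'I_k') (w f : kform V k) (w' f' : kform V k') :
  bijective b -> (forall u, f' u = f (u \o b)) ->
  is_antisymmetrization w f -> is_antisymmetrization w' f' ->
  nonzero_form w -> nonzero_form w'.
Proof.
move=> bij_b f'E [c _ wE] [c' c'0 w'E] [v wv].
have [b' bK _] := bij_b; exists (v \o b').
rewrite w'E mulf_neq0//; have -> : f' = fun u => f (u \o b) by exact/funext.
rewrite antisymmetrize_reindex// (_ : _ \o b = v); last first.
  by apply/funext => i /=; rewrite bK.
by move: wv; rewrite wE; apply: contra_neq => ->; rewrite mulr0.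
Qed.

Lemma nonzero_wedgeA p q r s (a : kform V p) (b : kform V q) (c : kform V r)
    (d : kform V s) :
  nonzero_form (wedge (wedge (wedge a b) c) d) ->
  nonzero_form (wedge a (wedge (wedge b c) d)).
Proof.
have e : (p + q + r + s = p + (q + r + s))%N by rewrite !addnA.
apply: (nonzero_reindex (b := cast_ord e)
  (f := tensor (tensor (tensor a b) c) d) (f' := tensor a (tensor (tensor b c) d))).
- by exists (cast_ord (esym e)) => i; apply/val_inj.
- move=> u; rewrite /tensor !mulrA; congr (a _ * b _ * c _ * d _);
    apply/funext => i /=; congr u; apply/val_inj => /=; lia.
- by do 2 apply: antisym_wedgel; exact: antisym_wedge.
- by apply: antisym_wedger; apply: antisym_wedgel; exact: antisym_wedge.
Qed.

(** Moving [b] to the front reorders the blocks of arguments, through the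
    bijection [f] below. *)
Lemma nonzero_wedgeCA p q r (a : kform V p) (b : kform V q) (c : kform V r) :
  nonzero_form (wedge (wedge a b) c) -> nonzero_form (wedge b (wedge a c)).
Proof.
pose f (i : 'I_(p + q + r)) : 'I_(q + (p + r)) :=
  match fintype.split i with
  | inl i' => match fintype.split i' with
              | inl x => rshift q (lshift r x)
              | inr y => lshift (p + r) y
              end
  | inr z => rshift q (rshift p z)
  end.
have f_inj : injective f.
{ move=> i j; rewrite /f.
  case: (split_ordP i) => i' ->; case: (split_ordP j) => j' ->;
  rewrite ?(unsplitK (inl _)) ?(unsplitK (inr _)).
  all: try case: (split_ordP i') => i'' ->.
  all: try case: (split_ordP j') => j'' ->.
  all: rewrite ?(unsplitK (inl _)) ?(unsplitK (inr _)).
  all: repeat match goal with x : 'I__ |- _ => case: x => ? ? end.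
  all: by move=> /(congr1 (@nat_of_ord _)) /= e; apply/val_inj => /=; lia. }
apply: (nonzero_reindex (b := f)
  (f := tensor (tensor a b) c) (f' := tensor b (tensor a c))).
- by apply: inj_card_bij => //; rewrite !card_ord; lia.
- move=> u; rewrite /tensor mulrA [b _ * _]mulrC; congr (a _ * b _ * c _);
    apply/funext => i /=; congr u; rewrite /f.
  + by rewrite (unsplitK (inl _)) (unsplitK (inl _)).
  + by rewrite (unsplitK (inl _)) (unsplitK (inr _)).
  + by rewrite (unsplitK (inr _)).
- by apply: antisym_wedgel; exact: antisym_wedge.
- by apply: antisym_wedger; exact: antisym_wedge.
Qed.

Definition upd k (v : 'I_k -> V) (i : 'I_k) (x : V) : 'I_k -> V :=
  fun j => if j == i then x else v j.

Definition alternating k (w : kform V k) : Prop :=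
  forall v (s : 'S_k), w (fun i => v (s i)) = (-1) ^+ s * w v.

Definition multilinear k (w : kform V k) : Prop :=
  forall i v a x y, w (upd v i (a *: x + y)) = a * w (upd v i x) + w (upd v i y).

Lemma alternating_wedge k l (w : kform V k) (t : kform V l) :
  alternating (wedge w t).
Proof. by move=> v s; rewrite !wedgeE antisymmetrize_perm mulrCA. Qed.

Lemma multilinear_wedge k l (w : kform V k) (t : kform V l) :
  multilinear w -> multilinear t -> multilinear (wedge w t).
Proof.
move=> ml_w ml_t i v a x y; rewrite !wedgeE [a * _]mulrCA -mulrDr; congr (_ * _).
rewrite /antisymmetrize mulr_sumr -big_split; apply: eq_bigr => s _ /=.
rewrite [a * _]mulrCA -mulrDr /tensor; congr (_ * _).
have updE z : (fun j => upd v i z (s j)) =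
    (fun j => if j == s^-1%g i then z else v (s j)).
  by apply/funext => j; rewrite /upd (canF_eq (permK s)).
rewrite !updE; case: (split_ordP (s^-1%g i)) => j ->.
- have l1 z : (fun j0 => if j0 == lshift l j then z else v (s j0)) \o @lshift k l
      = upd (fun j => v (s (lshift l j))) j z.
    by apply/funext => j' /=; rewrite (inj_eq (@lshift_inj _ _)).
  have r1 z : (fun j0 => if j0 == lshift l j then z else v (s j0)) \o @rshift k l
      = (fun j => v (s (rshift k j))).
    by apply/funext => j' /=; rewrite eq_rlshift.
  by rewrite !l1 !r1 ml_w mulrDl mulrA.
- have l1 z : (fun j0 => if j0 == rshift k j then z else v (s j0)) \o @rshift k l
      = upd (fun j => v (s (rshift k j))) j z.
    by apply/funext => j' /=; rewrite (inj_eq (@rshift_inj _ _)).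
  have r1 z : (fun j0 => if j0 == rshift k j then z else v (s j0)) \o @lshift k l
      = (fun j => v (s (lshift l j))).
    by apply/funext => j' /=; rewrite eq_lrshift.
  by rewrite !l1 !r1 ml_t mulrDr mulrCA.
Qed.

Lemma multilinear_wedge_pow k (w : kform V k) n :
  multilinear w -> multilinear (wedge_pow w n).
Proof.
move=> ml_w; elim: n => [|n IHn]; first by case.
exact: multilinear_wedge.
Qed.

Lemma multilinear_scalar (f : {scalar V}) : multilinear (kform_of_scalar f).
Proof.
move=> i v a x y; rewrite /kform_of_scalar (ord1 i) /upd eqxx.
by rewrite linearP.
Qed.

End KForms.

(** * The kernel of a form of codegree one *)

Section AlternatingForms.
Context (R : realType) (V : lmodType R).

Definition cons_vec k (x : V) (v : 'I_k -> V) : 'I_k.+1 -> V :=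
  fun i => oapp v x (unlift ord0 i).

(** Contraction of [w] with [x], phrased without singling out the first
    argument; for alternating forms this is [i(x) w = 0], see
    [kills_interior]. *)
Definition kills k (x : V) (w : kform V k) : Prop :=
  forall v i, v i = x -> w v = 0.

Lemma cons_vec0 k x (v : 'I_k -> V) : cons_vec x v ord0 = x.
Proof. by rewrite /cons_vec unlift_none. Qed.

Lemma cons_vec_lift k x (v : 'I_k -> V) i : cons_vec x v (lift ord0 i) = v i.
Proof. by rewrite /cons_vec liftK. Qed.

Lemma cons_vecE k x (v u : 'I_k.+1 -> V) :
  v ord0 = x -> (forall i, v (lift ord0 i) = u (lift ord0 i)) ->
  v = cons_vec x (fun i => u (lift ord0 i)).
Proof.
move=> v0 vl; apply/funext => i; case: (unliftP ord0 i) => [j ->|->].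
  by rewrite cons_vec_lift.
by rewrite cons_vec0.
Qed.

Lemma upd_id k (v : 'I_k -> V) i : upd v i (v i) = v.
Proof. by apply/funext => j; rewrite /upd; case: eqP => [->|]. Qed.

Lemma multilinear_sum k (w : kform V k) (I : finType) i v (c : I -> R) (x : I -> V) :
  multilinear w ->
  w (upd v i (\sum_b c b *: x b)) = \sum_b c b * w (upd v i (x b)).
Proof.
move=> ml_w; elim/big_rec2: _ => [|b y z _ <-]; last by rewrite ml_w.
have := ml_w i v (-1) 0 0; rewrite scaler0 addr0 => ->.
by rewrite mulN1r addNr.
Qed.

Lemma alternating_eq0 k (w : kform V k) v i j :
  alternating w -> i != j -> v i = v j -> w v = 0.
Proof.
move=> alt_w ij vij; have := alt_w v (tperm i j); rewrite odd_tperm ij mulN1r.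
have -> : (fun l => v (tperm i j l)) = v.
  by apply/funext => l; case: tpermP => // ->.
by move=> wN; apply/eqP; rewrite -[_ == _](mulrn_eq0 (w v) 2) mulr2n {1}wN addNr.
Qed.

Lemma kills_interior k (w : kform V k) x :
  alternating w -> (forall v, Defs.interior x w v = 0) <-> kills x w.
Proof.
case: k w => [|k] w alt_w; first by split => // _ v [].
split=> [x0 v i vi|xw v]; last by apply: (xw _ ord0); exact: cons_vec0.
have wu : w (cons_vec x (fun j => v (tperm ord0 i (lift ord0 j)))) = 0 by exact: x0.
have := alt_w v (tperm ord0 i).
have -> : (fun j => v (tperm ord0 i j)) =
    cons_vec x (fun j => v (tperm ord0 i (lift ord0 j))).
  by apply: (@cons_vecE _ x _ (fun j => v (tperm ord0 i j))); rewrite ?tpermL.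
rewrite wu.
by move=> /esym/eqP; rewrite mulf_eq0 signr_eq0 => /eqP.
Qed.

Lemma alternating_cons k (w : kform V k.+1) x :
  alternating w -> alternating (fun v => w (cons_vec x v)).
Proof.
move=> alt_w v s; have := alt_w (cons_vec x v) (lift_perm ord0 ord0 s).
rewrite odd_lift_perm addbb => <-; congr w; apply/funext => i.
case: (unliftP ord0 i) => [j ->|->].
  by rewrite lift_perm_lift !cons_vec_lift.
by rewrite lift_perm_id !cons_vec0.
Qed.

Lemma cons_upd k x (v : 'I_k -> V) i y :
  cons_vec x (upd v i y) = upd (cons_vec x v) (lift ord0 i) y.
Proof.
apply/funext => j; rewrite /upd; case: (unliftP ord0 j) => [l ->|->].
  by rewrite !cons_vec_lift (inj_eq lift_inj).
by rewrite !cons_vec0 (negPf (neq_lift _ _)).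
Qed.

Lemma upd_cons0 k x y (v : 'I_k -> V) : upd (cons_vec x v) ord0 y = cons_vec y v.
Proof.
apply/funext => j; rewrite /upd; case: (unliftP ord0 j) => [l ->|->].
  by rewrite !cons_vec_lift eq_sym (negPf (neq_lift _ _)).
by rewrite !cons_vec0 eqxx.
Qed.

Lemma multilinear_cons k (w : kform V k.+1) x :
  multilinear w -> multilinear (fun v => w (cons_vec x v)).
Proof. by move=> ml_w i v a y z; rewrite !cons_upd ml_w. Qed.

End AlternatingForms.

Section Spanning.
Context (R : realType) (V : lmodType R) (n : nat) (e : 'I_n -> V).
Hypothesis e_span : forall v, exists c : 'I_n -> R, v = \sum_b c b *: e b.

(** Expand one argument after the other on the spanning family: [l] counts the
    arguments that need not belong to it yet. *)
Lemma multilinear_span0 k (w : kform V k) :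
  multilinear w -> (forall f, w (fun i => e (f i)) = 0) -> forall v, w v = 0.
Proof.
move=> ml_w wf.
have main l v : (forall i : 'I_k, (l <= i)%N -> exists b, v i = e b) -> w v = 0.
  elim: l v => [|l IHl] v vl.
    have vf i : {b | v i = e b} by exact: cid (vl i isT).
    rewrite -(wf (fun i => projT1 (vf i))); congr w; apply/funext => i.
    exact: projT2 (vf i).
  have [kl|lk] := leqP k l.
    by apply: IHl => i li; case: (leqP k l) kl => // kl _; have := ltn_ord i; lia.
  pose i := Ordinal lk; have [c vi] := e_span (v i).
  rewrite -(upd_id v i) {}vi multilinear_sum//; apply: big1 => b _.
  rewrite [X in _ * X]IHl ?mulr0// => j lj; rewrite /upd.
  have [_|ji] := eqVneq j i; first by exists b.
  by apply: vl; rewrite ltn_neqAle lj andbT eq_sym.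
by move=> v; apply: (main k) => i; rewrite leqNgt ltn_ord.
Qed.

Lemma alternating_noninj k (w : kform V k) (f : 'I_k -> 'I_n) :
  alternating w -> ~ injective f -> w (fun i => e (f i)) = 0.
Proof.
move=> alt_w ninj; have /injectivePn[i [j ij fij]] : ~~ injectiveb f.
  by apply/negP => /injectiveP.
by apply: alternating_eq0 alt_w ij _; rewrite fij.
Qed.

End Spanning.

Section ReebVector.
Context (R : realType) (V : lmodType R) (m : nat) (e : 'I_m.+1 -> V).
Hypothesis e_span : forall v, exists c : 'I_m.+1 -> R, v = \sum_b c b *: e b.

Lemma top_form_perm (w : kform V m.+1) (f : 'I_m.+1 -> 'I_m.+1) :
  alternating w -> injective f ->
  exists s : bool, w (fun i => e (f i)) = (-1) ^+ s * w e.
Proof.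
move=> alt_w f_inj; exists (perm f_inj); rewrite -alt_w; congr w.
by apply/funext => i; rewrite permE.
Qed.

Lemma top_form_neq0 (w : kform V m.+1) :
  alternating w -> multilinear w -> nonzero_form w -> w e != 0.
Proof.
move=> alt_w ml_w [v]; apply: contra_neq => we.
apply: (multilinear_span0 e_span ml_w) => f.
have [f_inj|f_ninj] := pselect (injective f).
  by have [s ->] := top_form_perm alt_w f_inj; rewrite we mulr0.
exact: alternating_noninj alt_w f_ninj.
Qed.

(** Up to order, a repetition-free choice of [m] among [m.+1] vectors is the
    choice of the omitted one. *)
Lemma subtop_form_eq0 (w : kform V m) :
  alternating w -> multilinear w ->
  (forall b : 'I_m.+1, w (fun i : 'I_m => e (lift b i)) = 0) ->
  forall v, w v = 0.
Proof.
move=> alt_w ml_w wl; apply: (multilinear_span0 e_span ml_w) => f.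
have [f_inj|f_ninj] := pselect (injective f); last first.
  exact: alternating_noninj alt_w f_ninj.
(* [m] values cannot exhaust ['I_m.+1]; [b] is the omitted one. *)
have [b bf] : exists b, b \notin codom f.
  apply: contrapT => all_f.
  have : (#|'I_m.+1| <= #|codom f|)%N.
    apply: subset_leq_card; apply/fintype.subsetP => b _.
    by apply/negPn/negP => bf; apply: all_f; exists b.
  by rewrite (card_codom f_inj) !card_ord ltnn.
have gP i : {j | lift b j = f i}.
  case: (unliftP b (f i)) => [j ->|fi]; first by exists j.
  by move: bf; rewrite -fi codom_f.
pose g i := projT1 (gP i).
have gE i : lift b (g i) = f i by exact: projT2 (gP i).
have g_inj : injective g by move=> i j gij; apply: f_inj; rewrite -!gE gij.
have := alt_w (fun i => e (lift b i)) (perm g_inj); rewrite wl mulr0 => <-.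
by congr w; apply/funext => i; rewrite permE gE.
Qed.

Section Pair.
Variables (a : {scalar V}) (w : kform V m).
Hypotheses (alt_w : alternating w) (ml_w : multilinear w).
Let vol : kform V m.+1 := wedge (kform_of_scalar a) w.
Hypothesis vol_neq0 : nonzero_form vol.

Let alt_vol : alternating vol. Proof. exact (@alternating_wedge _ _ 1 m _ _). Qed.

Let ml_vol : multilinear vol.
Proof.
exact (@multilinear_wedge _ _ 1 m _ _ (@multilinear_scalar _ _ a) ml_w).
Qed.

(** In each term of the wedge product, [x] is an argument of [a] or of [w]. *)
Lemma kills_wedge x : a x = 0 -> kills x w -> kills x vol.
Proof.
move=> ax xw v i vi; rewrite /vol wedgeE /antisymmetrize big1 ?mulr0// => s _.
rewrite /tensor; case: (split_ordP (s^-1%g i)) => j sj.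
  rewrite [kform_of_scalar a _](_ : _ = 0) ?mul0r ?mulr0//.
  by rewrite /kform_of_scalar /= (ord1 j) in sj *; rewrite -sj permKV vi.
by rewrite [w _](xw _ j) ?mulr0//= -sj permKV.
Qed.

(** Putting [x] in place of the basis vector [e b] in [vol e] leaves the [b]-th
    coefficient of [x] times [vol e], since the other ones multiply a form with
    a repeated argument; and the result is 0 by [kills_wedge]. *)
Lemma kills_eq0 x : a x = 0 -> kills x w -> x = 0.
Proof.
move=> ax xw; have [c xc] := e_span x.
have vol_e := top_form_neq0 alt_vol ml_vol vol_neq0.
suff c0 b : c b = 0 by rewrite xc big1// => b _; rewrite c0 scale0r.
have : vol (upd e b x) = 0.
  by apply: (kills_wedge ax xw (i := b)); rewrite /upd eqxx.
rewrite {1}xc multilinear_sum// (bigD1 b)//= upd_id big1 ?addr0 => [|b' b'b].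
  by move=> /eqP; rewrite mulf_eq0 (negPf vol_e) orbF => /eqP.
rewrite (alternating_eq0 alt_vol (i := b) (j := b')) ?mulr0//.
  by rewrite eq_sym.
by rewrite /upd eqxx (negPf b'b).
Qed.

(** These are [vol e] up to sign; keeping them as values of the wedge product
    makes it unnecessary to know the signs. *)
Definition pivot (b : 'I_m.+1) : R := wedge (kform_of_scalar a) w
  (cons_vec (e b) (fun i => e (lift b i))).

(** The vector [x] with [w = i(x) (a /\ w)]: evaluating this equation on the
    basis without [e b] determines the [b]-th coefficient. *)
Definition kernel_vector : V :=
  \sum_(b < m.+1) (w (fun i : 'I_m => e (lift b i)) / pivot b) *: e b.

Lemma pivot_neq0 b : pivot b != 0.
Proof.
(* The family in [pivot] is the basis reordered by the injection [f]. *)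
pose f (i : 'I_m.+1) := oapp (lift b) b (unlift ord0 i).
have f_inj : injective f.
  move=> i j; rewrite /f; case: (unliftP ord0 i) => [i' ->|->];
  case: (unliftP ord0 j) => [j' ->|->]; rewrite ?liftK ?unlift_none//=.
  - by move=> /lift_inj ->.
  - by move=> /eqP; rewrite eq_sym (negPf (neq_lift _ _)).
  - by move=> /eqP; rewrite (negPf (neq_lift _ _)).
have [s fs] := top_form_perm alt_vol f_inj.
have -> : pivot b = vol (fun i => e (f i)).
  congr vol; apply/funext => i; rewrite /cons_vec /f.
  by case: (unlift ord0 i).
by rewrite fs mulf_neq0 ?signr_eq0//; exact: top_form_neq0.
Qed.

Lemma kernel_vectorP v : w v = vol (cons_vec kernel_vector v).
Proof.
apply/eqP; rewrite -subr_eq0; apply/eqP; move: v.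
pose w' := fun v : 'I_m -> V => vol (cons_vec kernel_vector v).
have alt' : alternating w' by exact: alternating_cons.
have ml' : multilinear w' by exact: multilinear_cons.
apply: (@subtop_form_eq0 (fun v => w v - w' v)) => [v s|i v c x y|b].
- by rewrite alt_w alt' mulrBr.
- by rewrite ml_w ml'; ring.
- rewrite /w' -(upd_cons0 0) multilinear_sum// (bigD1 b)//= big1 ?addr0.
    by rewrite upd_cons0 divfK ?subrr//; exact: pivot_neq0.
  move=> b' b'b; rewrite upd_cons0.
  case: (unliftP b b') b'b => [j ->|->]; last by rewrite eqxx.
  rewrite (alternating_eq0 alt_vol (i := ord0) (j := lift ord0 j)) ?mulr0//.
  by rewrite cons_vec0 cons_vec_lift.
Qed.

Lemma kills_kernel_vector : kills kernel_vector w.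
Proof.
move=> v i vi; rewrite kernel_vectorP.
apply: (alternating_eq0 alt_vol (i := ord0) (j := lift ord0 i)) => //.
by rewrite cons_vec0 cons_vec_lift.
Qed.

Lemma kernel_vector_neq0 : a kernel_vector != 0.
Proof.
apply/eqP => ak; have k0 := kills_eq0 ak kills_kernel_vector.
have w0 v : w v = 0.
  rewrite kernel_vectorP k0 -(upd_cons0 0).
  have := ml_vol ord0 (cons_vec 0 v) (-1) 0 0; rewrite scaler0 addr0 => ->.
  by rewrite mulN1r addNr.
have [v] := vol_neq0; rewrite /vol wedgeE /antisymmetrize big1 ?mulr0 ?eqxx// => s _.
by rewrite /tensor w0 !mulr0.
Qed.

Definition reeb_vector : V := (a kernel_vector)^-1 *: kernel_vector.

Lemma reeb_vectorP : a reeb_vector = 1 /\ kills reeb_vector w.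
Proof.
split; first by rewrite linearZ /= mulVf//; exact: kernel_vector_neq0.
move=> v i vi; rewrite -(upd_id v i) vi.
have := ml_w i v (a kernel_vector)^-1 kernel_vector 0.
rewrite addr0 => ->; rewrite (kills_kernel_vector (i := i)) ?mulr0 ?add0r.
  have := ml_w i v (-1) 0 0; rewrite scaler0 addr0 => ->.
  by rewrite mulN1r addNr.
by rewrite /upd eqxx.
Qed.

Lemma reeb_vector_unique x : a x = 1 -> kills x w -> x = reeb_vector.
Proof.
move=> ax xw; have [ar rw] := reeb_vectorP.
apply/eqP; rewrite -subr_eq0; apply/eqP; apply: kills_eq0.
  by rewrite linearB /= ax ar subrr.
move=> v i vi; rewrite -(upd_id v i) vi.
have := ml_w i v (-1) reeb_vector x; rewrite scaleN1r addrC => ->.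
by rewrite (rw _ i) ?(xw _ i) ?mulr0 ?addr0// /upd eqxx.
Qed.

End Pair.
End ReebVector.

(** * Symmetry of mixed derivatives *)

Section Derivatives.
Context (R : realType).

Lemma near_eq_differentiable (V W : normedModType R) (f g : V -> W) (x : V) :
  (\near x, f x = g x) -> differentiable f x -> differentiable g x.
Proof.
move=> fg df; have gE : g \o shift x = cst (g x) + 'd f x +o_ (0 : V) id.
  have fg0 : \forall y \near (0 : V), f (y + x) = g (y + x).
    by move: fg; rewrite (near_shift 0 x) /= subr0.
  have /eqaddoP df' := diff_locally df; apply/eqaddoP => e e0.
  have := df' e e0; apply: filter_app; near=> y.
  by rewrite !fctE /= -(nbhs_singleton fg) (near fg0 y).
have dE := diff_unique (diff_continuous df) gE.
by apply/diff_locallyP; rewrite dE; split => //; exact: diff_continuous.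
Unshelve. all: by end_near. Qed.

Lemma derive_shiftE (V W : normedModType R) (f : V -> W) (c y v : V) :
  'D_v (fun z => f (z + c)) y = 'D_v f (y + c).
Proof. by rewrite /derive /=; under eq_fun do rewrite -addrA. Qed.

Lemma differentiable_shift (V W : normedModType R) (f : V -> W) (c y : V) :
  differentiable f (y + c) -> differentiable (fun z => f (z + c)) y.
Proof.
by move=> df; apply: (@differentiable_comp _ _ _ _ (fun z => z + c) f).
Qed.

Lemma mean_value_line (V : normedModType R) (f : V -> R) (a v : V) (t : R) :
  0 < t -> (forall s, 0 <= s <= t -> differentiable f (a + s *: v)) ->
  exists2 s, 0 < s < t & f (a + t *: v) - f a = t * 'D_v f (a + s *: v).
Proof.
move=> t0 df; pose g (s : R) := f (a + s *: v).
have dg s : 0 <= s <= t -> differentiable g s /\ 'D_1 g s = 'D_v f (a + s *: v).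
  move=> st; have dl : is_diff (s : R^o) (fun s : R^o => a + s *: v) ( *:%R ^~ v).
    have := is_diffD (is_diff_cst a (s : R^o)) (is_diff_scalel (s : R^o) v).
    by rewrite add0r.
  have dgs : differentiable g s.
    apply: (@differentiable_comp _ _ _ _ (fun s : R^o => a + s *: v) f) => //.
    exact: df.
  split=> //; rewrite !deriveE//; last exact: df.
  rewrite (@diff_comp _ _ _ _ (fun s : R^o => a + s *: v) f) //=; last exact: df.
  by rewrite diff_val scale1r.
have := @MVT R g (fun s => 'D_v f (a + s *: v)) 0 t t0.
case=> [s||s st].
- rewrite in_itv /= => /andP[s0 st]; have [|dgs <-] := dg s; first by rewrite !ltW.
  by apply: derivableP; exact: diff_derivable.
- apply: continuous_in_subspaceT => s; rewrite inE /= in_itv /= => st.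
  by apply: differentiable_continuous; have [] := dg s st.
- rewrite /g scale0r addr0 subr0 mulrC => ->.
  by exists s => //; move: st; rewrite in_itv.
Qed.

(** Two applications of the mean value theorem, along [u] and then along [v],
    give the second difference exactly as [t ^+ 2] times the mixed derivative
    at an intermediate point, which tends to [x] with [t]. *)
Lemma second_difference_approx (V : normedModType R) (f : V -> R) (U : set V)
    (x u v : V) :
  open U -> U x -> (forall y, U y -> differentiable f y) ->
  (forall y, U y -> differentiable ('D_u f) y) ->
  {for x, continuous ('D_v ('D_u f))} ->
  forall e, 0 < e -> exists2 d, 0 < d & forall t, 0 < t < d ->
    `|f (x + t *: u + t *: v) - f (x + t *: u) - (f (x + t *: v) - f x)
      - t ^+ 2 * 'D_v ('D_u f) x| <= e * t ^+ 2.
Proof.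
move=> oU Ux df ddf cD e e0.
have UB : nbhs x (U `&` [set y | `|'D_v ('D_u f) x - 'D_v ('D_u f) y| < e]).
  apply: filterI; first by apply: open_nbhs_nbhs.
  by move/cvgrPdist_lt : cD; apply.
move/nbhs_ballP : UB => [r r0 rU].
have uv0 : 0 < `|u| + `|v| + 1 by rewrite ltr_wpDl ?addr_ge0.
(* For [t] below this bound the parallelogram spanned by [t *: u] and [t *: v]
   stays in the ball; the summand 1 covers [u = v = 0]. *)
exists (r / (`|u| + `|v| + 1)); first exact: divr_gt0.
move=> t /andP[t0]; rewrite ltr_pdivlMr// => tr.
have inB (a b : R) : 0 <= a <= t -> 0 <= b <= t ->
    ball x r (x + a *: u + b *: v).
  move=> /andP[a0 at_] /andP[b0 bt]; rewrite -ball_normE /=.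
  rewrite opprD addrA opprD addrA subrr add0r.
  rewrite -opprD normrN (le_lt_trans (ler_normD _ _))//.
  rewrite !normrZ !ger0_norm// (le_lt_trans _ tr)// !mulrDr mulr1.
  by apply: ler_wpDr; [exact: ltW|apply: lerD; exact: ler_wpM2r].
(* The second difference is the increment of [F] along [t *: u]. *)
pose F y := f (y + t *: v) - f y.
have t0t : 0 <= t <= t by rewrite ltW//=.
have z0t : 0 <= (0 : R) <= t by rewrite lexx ltW.
have dF y : differentiable f y -> differentiable f (y + t *: v) ->
    differentiable F y /\ 'D_u F y = 'D_u f (y + t *: v) - 'D_u f y.
  move=> dfy dfyt; have dfs := differentiable_shift dfyt.
  split; first exact: differentiableB.
  by rewrite /F deriveB ?derive_shiftE//; exact: diff_derivable.
have dFs s : 0 <= s <= t -> differentiable F (x + s *: u) /\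
    'D_u F (x + s *: u) = 'D_u f (x + s *: u + t *: v) - 'D_u f (x + s *: u).
  move=> st; apply: dF; apply: df; last by case: (rU _ (inB _ _ st t0t)).
  by have := inB _ _ st z0t; rewrite scale0r addr0 => /rU[].
have [s /andP[s0 st] Fs] := mean_value_line t0 (fun s st => (dFs s st).1).
have {}st : 0 <= s <= t by rewrite !ltW.
have [|b /andP[b0 bt] Db] := @mean_value_line _ ('D_u f) (x + s *: u) v t t0.
  by move=> b bt; apply: ddf; case: (rU _ (inB _ _ st bt)).
have {}bt : 0 <= b <= t by rewrite !ltW.
have /rU[_ /= Dsb] := inB _ _ st bt.
rewrite -[X in `|X - _|]/(F (x + t *: u) - F x) Fs (dFs s st).2 Db mulrA -expr2.
have t2 : 0 <= t ^+ 2 by exact: sqr_ge0.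
move: t2 Dsb; move: ('D_v _ (x + _ + _)) ('D_v _ x) (t ^+ 2) => B A q q0 AB.
rewrite -mulrBr normrM (ger0_norm q0) mulrC.
by apply: (ler_wpM2r q0); rewrite distrC; exact: ltW.
Qed.

(** The second difference in [second_difference_approx] is symmetric in [u] and
    [v]. *)
Lemma derive_comm (V : normedModType R) (f : V -> R) (U : set V) (x u v : V) :
  open U -> U x -> (forall y, U y -> differentiable f y) ->
  (forall w y, U y -> differentiable ('D_w f) y) ->
  (forall w w', {for x, continuous ('D_w ('D_w' f))}) ->
  'D_u ('D_v f) x = 'D_v ('D_u f) x.
Proof.
move=> oU Ux df ddf cD; apply/eqP; rewrite -subr_eq0 -normr_le0.
apply/ler_addgt0Pr => e e0; rewrite add0r.
have e20 : 0 < e / 2 by rewrite divr_gt0.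
have [d d0 dP] := second_difference_approx oU Ux df (ddf u) (cD v u) e20.
have [d' d'0 d'P] := second_difference_approx oU Ux df (ddf v) (cD u v) e20.
pose t := Num.min d d' / 2.
have m0 : 0 < Num.min d d' by rewrite lt_min d0.
have t0 : 0 < t by rewrite divr_gt0.
have tm : t < Num.min d d' by rewrite /t ltr_pdivrMr// ltr_pMr// ltr1n.
have t2 : 0 < t ^+ 2 by rewrite exprn_gt0.
move: tm; rewrite lt_min => /andP[td td'].
have /(_ t) := dP; rewrite t0 td => /(_ isT) P1.
have /(_ t) := d'P; rewrite t0 td' => /(_ isT) P2.
rewrite [x + t *: v + _]addrAC in P2.
move: P1 P2 t2; move: ('D_u _ x) ('D_v _ x) (f _) (f _) (f _) (f _) (t ^+ 2).
move=> A B a b c d1 q; rewrite !ler_norml => /andP[h1 h2] /andP[h3 h4] q0.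
rewrite -[X in X && _](ler_pM2r q0) -[X in _ && X](ler_pM2r q0).
by apply/andP; split; lra.
Qed.

End Derivatives.

(** * Smooth functions on an open set *)

Section SmoothFunctions.
Context (R : realType) (n : nat) (U : set 'rV[R]_n).
Hypothesis oU : open U.

Lemma near_open (P : 'rV[R]_n -> Prop) x : U x -> (forall y, U y -> P y) ->
  \forall y \near x, P y.
Proof.
move=> Ux UP; have : nbhs x U by apply: open_nbhs_nbhs.
by apply: filterS.
Qed.

Lemma Ck_on_eq (W : normedModType R) k (f g : 'rV[R]_n -> W) :
  (forall y, U y -> f y = g y) -> Ck_on k U f -> Ck_on k U g.
Proof.
elim: k f g => [|k IHk] f g fg /=.
  move=> cf x Ux; rewrite /prop_for /continuous_at -(fg _ Ux).
  have gf : g @ x `=>` f @ x by apply: (@near_eq_cvg _ _ (nbhs x)); exact: near_open.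
  exact: (cvg_trans gf (cf x Ux)).
move=> [df ckf]; split=> [x Ux|v].
  by apply: near_eq_differentiable (df x Ux); exact: (near_open Ux fg).
apply: IHk (ckf v) => y Uy; apply: near_eq_derive; exact: (near_open Uy fg).
Qed.

Lemma Ck_onW (W : normedModType R) k (f : 'rV[R]_n -> W) :
  Ck_on k.+1 U f -> Ck_on k U f.
Proof.
elim: k f => [|k IHk] f.
  by move=> [df _] x Ux; exact: differentiable_continuous (df x Ux).
by move=> [df ckf]; split=> // v; apply: IHk.
Qed.

Lemma Ck_on_linear (W W' : normedModType R) (L : {linear W -> W'}) k
    (f : 'rV[R]_n -> W) : continuous L -> Ck_on k U f -> Ck_on k U (L \o f).
Proof.
move=> cL; elim: k f => [|k IHk] f.
  by move=> cf x Ux; apply: continuous_comp; [exact: cf|exact: cL].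
move=> [df ckf]; split=> [x Ux|v].
  by apply: differentiable_comp; [exact: df|exact: linear_differentiable].
apply: Ck_on_eq (IHk _ (ckf v)) => y Uy /=.
have dfy := df y Uy.
have dL : differentiable L (f y) by exact: linear_differentiable.
have dLf : differentiable (L \o f) y by exact: differentiable_comp.
by rewrite (deriveE v dLf) (deriveE v dfy) (diff_comp dfy dL) /= diff_lin.
Qed.

Lemma Ck_on_cst (W : normedModType R) k (c : W) : Ck_on k U (fun=> c).
Proof.
elim: k c => [|k IHk] c /=; first by move=> x _; exact: cst_continuous.
split=> [x _|v]; first exact: differentiable_cst.
by apply: Ck_on_eq (IHk 0) => y _; rewrite derive_cst.
Qed.

Lemma Ck_onD (W : normedModType R) k (f g : 'rV[R]_n -> W) :
  Ck_on k U f -> Ck_on k U g -> Ck_on k U (fun y => f y + g y).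
Proof.
elim: k f g => [|k IHk] f g.
  by move=> cf cg x Ux; exact: (cvgD (cf x Ux) (cg x Ux)).
move=> [df ckf] [dg ckg]; split=> [x Ux|v].
  exact: (differentiableD (df x Ux) (dg x Ux)).
apply: Ck_on_eq (IHk _ _ (ckf v) (ckg v)) => y Uy.
exact: (esym (deriveD (diff_derivable (df y Uy)) (diff_derivable (dg y Uy)))).
Qed.

Lemma Ck_onM k (f g : 'rV[R]_n -> R^o) :
  Ck_on k U f -> Ck_on k U g -> Ck_on k U (fun y => f y * g y : R^o).
Proof.
elim: k f g => [|k IHk] f g.
  by move=> cf cg x Ux; exact: (cvgM (cf x Ux) (cg x Ux)).
move=> ckf ckg; have [df Df] := ckf; have [dg Dg] := ckg; split=> [x Ux|v].
  exact: (differentiableM (df x Ux) (dg x Ux)).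
have := Ck_onD (IHk _ _ (Ck_onW ckf) (Dg v)) (IHk _ _ (Ck_onW ckg) (Df v)).
apply: Ck_on_eq => y Uy.
exact: (esym (deriveM (diff_derivable (df y Uy)) (diff_derivable (dg y Uy)))).
Qed.

Lemma Ck_onV k (f : 'rV[R]_n -> R^o) : (forall y, U y -> f y != 0) ->
  Ck_on k U f -> Ck_on k U (fun y => (f y)^-1 : R^o).
Proof.
move=> f0; elim: k f f0 => [|k IHk] f f0.
  by move=> cf x Ux; exact: (cvgV (f0 x Ux) (cf x Ux)).
move=> ckf; have [df Df] := ckf; split=> [x Ux|v].
  exact: (differentiableV (df x Ux) (f0 x Ux)).
have ckV := IHk f f0 (Ck_onW ckf).
have := Ck_onM (Ck_onM (Ck_onM (Ck_on_cst k (-1 : R^o)) ckV) ckV) (Df v).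
apply: Ck_on_eq => y Uy.
rewrite (deriveV (f0 y Uy) (diff_derivable (df y Uy))).
by rewrite -exprVn expr2 mulN1r [X in X * _]mulNr.
Qed.

Lemma smooth_on_eq (W : normedModType R) (f g : 'rV[R]_n -> W) :
  (forall y, U y -> f y = g y) -> smooth_on U f -> smooth_on U g.
Proof. by move=> fg sf k; exact: Ck_on_eq fg (sf k). Qed.

Lemma smooth_on_cst (W : normedModType R) (c : W) : smooth_on U (fun=> c).
Proof. by move=> k; exact: Ck_on_cst. Qed.

Lemma smooth_on_sum (W : normedModType R) (I : Type) (r : seq I)
    (f : I -> 'rV[R]_n -> W) :
  (forall i, smooth_on U (f i)) -> smooth_on U (fun y => \sum_(i <- r) f i y).
Proof.
move=> sf; elim: r => [|i r IHr].
  by under eq_fun do rewrite big_nil; exact: smooth_on_cst.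
under eq_fun do rewrite big_cons.
by move=> k; apply: Ck_onD; [exact: sf|exact: IHr].
Qed.

Lemma smooth_onM (f g : 'rV[R]_n -> R^o) :
  smooth_on U f -> smooth_on U g -> smooth_on U (fun y => f y * g y : R^o).
Proof. by move=> sf sg k; exact: Ck_onM. Qed.

Lemma smooth_onV (f : 'rV[R]_n -> R^o) : (forall y, U y -> f y != 0) ->
  smooth_on U f -> smooth_on U (fun y => (f y)^-1 : R^o).
Proof. by move=> f0 sf k; exact: Ck_onV. Qed.

Lemma smooth_on_derive (W : normedModType R) (f : 'rV[R]_n -> W) v :
  smooth_on U f -> smooth_on U ('D_v f).
Proof. by move=> sf k; have [_] := sf k.+1; apply. Qed.

Lemma smooth_on_differentiable (W : normedModType R) (f : 'rV[R]_n -> W) y :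
  smooth_on U f -> U y -> differentiable f y.
Proof. by move=> /(_ 1%N)[df _]; exact: df. Qed.

Lemma smooth_on_scale (W : normedModType R) (f : 'rV[R]_n -> R^o) (w : W) :
  smooth_on U f -> smooth_on U (fun y => f y *: w).
Proof.
move=> sf k.
have sx_lin : linear ( *:%R ^~ w : R^o -> W) by move=> a y z; rewrite scalerDl scalerA.
pose sxL := GRing.isLinear.Build _ _ _ _ _ sx_lin.
pose L : {linear R^o -> W} := HB.pack ( *:%R ^~ w : R^o -> W) sxL.
by apply: (@Ck_on_linear _ _ L) (sf k) => a; exact: scalel_continuous.
Qed.

Lemma smooth_on_coord m (f : 'rV[R]_n -> 'rV[R]_m) b :
  smooth_on U f -> smooth_on U (fun y => f y 0 b : R^o).
Proof.
move=> sf k.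
have c_lin : linear (fun M : 'rV[R]_m => M 0 b : R^o).
  by move=> a y z; rewrite !mxE.
pose cL := GRing.isLinear.Build _ _ _ _ _ c_lin.
pose L : {linear 'rV[R]_m -> R^o} := HB.pack (fun M : 'rV[R]_m => M 0 b : R^o) cL.
by apply: (@Ck_on_linear _ _ L) (sf k) => a; exact: coord_continuous.
Qed.

Lemma smooth_on_derive_comm (f : 'rV[R]_n -> R^o) x u v :
  smooth_on U f -> U x -> 'D_u ('D_v f) x = 'D_v ('D_u f) x.
Proof.
move=> sf Ux; have [df _] := sf 1%N.
apply: (@derive_comm R 'rV[R]_n f U x u v oU Ux df) => [w y Uy|w w'].
  by apply: smooth_on_differentiable Uy; exact: smooth_on_derive.
by have := smooth_on_derive w (smooth_on_derive w' sf) 0%N; apply.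
Qed.

End SmoothFunctions.

(** * Coordinates on tangent spaces *)

Section Charts.
Context (R : realType) (n : nat) (M : smooth_manifold R n).
Implicit Types (i j : atlas_index M) (p : M).

Lemma chart_imgK i y : chart_img (atlas i) y ->
  chart_dom (atlas i) (chart_inv (atlas i) y) /\ atlas i (chart_inv (atlas i) y) = y.
Proof. by move=> [p ip <-]; rewrite chart_mapK. Qed.

Lemma chart_overlap_open i j :
  open (atlas i @` (chart_dom (atlas i) `&` chart_dom (atlas j))).
Proof.
rewrite openE => y [p [ip jp] py]; rewrite -py.
have iy : chart_img (atlas i) (atlas i p) by exists p.
have ni : nbhs (atlas i p) (chart_img (atlas i)).
  by apply: open_nbhs_nbhs; split => //; exact: chart_img_open.
have ci : {for atlas i p, continuous (chart_inv (atlas i))}.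
  have := chart_inv_cont (c := atlas i).
  rewrite continuous_open_subspace; last exact: chart_img_open.
  by apply; rewrite inE.
have nj : nbhs (chart_inv (atlas i) (atlas i p)) (chart_dom (atlas j)).
  rewrite chart_mapK//; apply: open_nbhs_nbhs; split => //; exact: chart_dom_open.
apply: filterS (filterI ni (ci _ nj)) => z [/chart_imgK[iz zE] jz].
by exists (chart_inv (atlas i) z).
Qed.

Lemma tangentZ p a (u : tangent p) i : (a *: u) i = a *: u i.
Proof. by []. Qed.

Lemma tangent_sum p (I : Type) (r : seq I) (u : I -> tangent p) i :
  (\sum_(b <- r) u b) i = \sum_(b <- r) u b i.
Proof. by elim/big_rec2: _ => // b x y _ <-. Qed.

Lemma tangent_change p (u : tangent p) i j :
  chart_dom (atlas i) p -> chart_dom (atlas j) p ->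
  u j = 'd (transition (atlas i) (atlas j)) (atlas i p) (u i).
Proof. by have /asboolP[_] := tangent_valP u; apply. Qed.

Lemma coord_vector_change i j p w :
  chart_dom (atlas i) p -> chart_dom (atlas j) p ->
  coord_vector i p w j = 'd (transition (atlas i) (atlas j)) (atlas i p) w.
Proof. by move=> ip jp; rewrite /= /coord_family; case: asboolP => // -[]. Qed.

(** The transition map from a chart to itself is the identity near the point
    considered. *)
Lemma coord_vectorE i p w : chart_dom (atlas i) p -> coord_vector i p w i = w.
Proof.
move=> ip; rewrite coord_vector_change// -deriveE; last exact: transition_differentiable.
rewrite (near_eq_derive _ (g := id)) ?derive_id//.
have Ui : (atlas i @` (chart_dom (atlas i) `&` chart_dom (atlas i))) (atlas i p).
  by exists p.
have tE y : (atlas i @` (chart_dom (atlas i) `&` chart_dom (atlas i))) y ->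
    transition (atlas i) (atlas i) y = id y.
  by move=> [q [iq _] <-]; rewrite /transition /= chart_mapK.
exact: (near_open (@chart_overlap_open i i) Ui tE).
Qed.

Lemma coord_vectorK i p (u : tangent p) : chart_dom (atlas i) p ->
  coord_vector i p (u i) = u.
Proof.
move=> ip; apply/val_inj/funext => j.
have [jp|njp] := pselect (chart_dom (atlas j) p).
  by rewrite [LHS]coord_vector_change// [RHS](tangent_change u ip jp).
have /asboolP[u0 _] := tangent_valP u; rewrite [RHS]u0//=.
by rewrite /coord_family; case: asboolP => // -[].
Qed.

Lemma coord_vectorP i p a u v :
  coord_vector i p (a *: u + v) = a *: coord_vector i p u + coord_vector i p v.
Proof.
apply/val_inj/funext => j.
change (coord_family i p (a *: u + v) j =
  a *: coord_family i p u j + coord_family i p v j :> 'rV[R]_n).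
rewrite /coord_family; case: asboolP => _; first by rewrite linearP.
by rewrite scaler0 addr0.
Qed.

Lemma coord_vector_sum i p (w : 'rV[R]_n) :
  coord_vector i p w = \sum_b w 0 b *: coord_vector i p (delta_mx 0 b).
Proof.
rewrite {1}(row_sum_delta w).
have c0 : coord_vector i p 0 = 0.
  by have := coord_vectorP i p (-1) 0 0; rewrite scaler0 addr0 scaleN1r addNr.
by elim/big_rec2: _ => // b x y _ <-; rewrite coord_vectorP.
Qed.

Lemma coord_basis_span i p (u : tangent p) : chart_dom (atlas i) p ->
  exists c : 'I_n -> R, u = \sum_b c b *: coord_vector i p (delta_mx 0 b).
Proof. by move=> ip; exists (u i 0); rewrite -coord_vector_sum coord_vectorK. Qed.

(** The coefficient of [a] on the coordinate field with constant coordinates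
    [w] in the chart [i]. *)
Definition local_coef (a : one_form M) i (w y : 'rV[R]_n) : R^o :=
  a (chart_inv (atlas i) y) (coord_vector i (chart_inv (atlas i) y) w).

Lemma local_coef_sum a i w y :
  local_coef a i w y = \sum_b w 0 b * local_coef a i (delta_mx 0 b) y.
Proof.
rewrite /local_coef coord_vector_sum linear_sum; apply: eq_bigr => b _.
by rewrite linearZ.
Qed.

Lemma local_coef_smooth a i w : smooth_on (chart_img (atlas i)) (local_coef a i w).
Proof. exact: covector_smooth. Qed.

Lemma derive_sumE m (f : 'I_m -> 'rV[R]_n -> R^o) x v :
  (forall b, differentiable (f b) x) ->
  'D_v (fun y => \sum_b f b y : R^o) x = \sum_b 'D_v (f b) x.
Proof.
move=> df; have -> : (fun y => \sum_b f b y : R^o) = \sum_b f b.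
  by apply/funext => y; rewrite fct_sumE.
by rewrite derive_sum// => b; exact: diff_derivable (df b).
Qed.

Lemma local_coef_differentiable a i w p : chart_dom (atlas i) p ->
  differentiable (local_coef a i w) (atlas i p).
Proof.
move=> ip; apply: (smooth_on_differentiable (local_coef_smooth a i w)).
by exists p.
Qed.

Lemma derive_local_coef_sum a i w u p : chart_dom (atlas i) p ->
  'D_u (local_coef a i w) (atlas i p) =
  \sum_b w 0 b * 'D_u (local_coef a i (delta_mx 0 b)) (atlas i p).
Proof.
move=> ip; have dl b := local_coef_differentiable a (delta_mx 0 b) ip.
have -> : local_coef a i w = fun y =>
    \sum_b (w 0 b *: local_coef a i (delta_mx 0 b) y : R^o).
  by apply/funext => y; rewrite local_coef_sum.
rewrite derive_sumE => [|b]; last exact: (differentiableZ _ (dl b)).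
by apply: eq_bigr => b _; rewrite deriveZ//; exact: diff_derivable (dl b).
Qed.

End Charts.

(** * The exterior derivative in an arbitrary chart *)

Section ExteriorDerivative.
Context (R : realType) (n : nat) (M : smooth_manifold R n) (a : one_form M).
Implicit Types (i j : atlas_index M) (p : M).

Let T i j b (y : 'rV[R]_n) : R^o := transition (atlas i) (atlas j) y 0 b.

Let overlap i j := atlas i @` (chart_dom (atlas i) `&` chart_dom (atlas j)).

Let T_smooth i j b : smooth_on (overlap i j) (T i j b).
Proof. by apply: smooth_on_coord; [exact: chart_overlap_open|exact: atlas_compat]. Qed.

Lemma derive_transition_coord i j b p w :
  chart_dom (atlas i) p -> chart_dom (atlas j) p ->
  'D_w (T i j b) (atlas i p) = 'd (transition (atlas i) (atlas j)) (atlas i p) w 0 b.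
Proof.
move=> ip jp; have dT := transition_differentiable ip jp.
rewrite -(deriveE w dT) derive_mx; last exact: diff_derivable dT.
by rewrite mxE.
Qed.

Lemma local_coef_change i j w p : chart_dom (atlas i) p -> chart_dom (atlas j) p ->
  local_coef a i w (atlas i p) =
  \sum_b 'D_w (T i j b) (atlas i p) *
    local_coef a j (delta_mx 0 b) (transition (atlas i) (atlas j) (atlas i p)).
Proof.
move=> ip jp; have tE : transition (atlas i) (atlas j) (atlas i p) = atlas j p.
  by rewrite /transition /= chart_mapK.
transitivity (local_coef a j (coord_vector i p w j) (atlas j p)).
  rewrite /local_coef (chart_mapK (c := atlas i))// (chart_mapK (c := atlas j))//.
  by rewrite coord_vectorK.
rewrite local_coef_sum tE; apply: eq_bigr => b _.
by rewrite derive_transition_coord// coord_vector_change.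
Qed.

(** The product rule applied to [local_coef_change] yields one term with first
    derivatives of the coefficients in the chart [j], and one with second
    derivatives of the transition map, symmetric in [u] and [w]. *)
Lemma derive_local_coef_change i j u w p :
  chart_dom (atlas i) p -> chart_dom (atlas j) p ->
  'D_u (local_coef a i w) (atlas i p) =
  'D_(coord_vector i p u j) (local_coef a j (coord_vector i p w j)) (atlas j p) +
  \sum_b local_coef a j (delta_mx 0 b) (atlas j p) *
         'D_u ('D_w (T i j b)) (atlas i p).
Proof.
move=> ip jp; pose t := transition (atlas i) (atlas j).
have tE : t (atlas i p) = atlas j p by rewrite /t /transition /= chart_mapK.
have oU : open (overlap i j) by exact: chart_overlap_open.
have Up : overlap i j (atlas i p) by exists p.
pose l b : 'rV[R]_n -> R^o := local_coef a j (delta_mx 0 b).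
pose F b y : R^o := 'D_w (T i j b) y * (l b \o t) y.
have lE y : overlap i j y -> local_coef a i w y = \sum_b F b y.
  by move=> [q [iq jq] <-]; exact: local_coef_change.
have dt : differentiable t (atlas i p) by exact: transition_differentiable.
have dl b : differentiable (l b) (t (atlas i p)).
  by rewrite tE; exact: local_coef_differentiable.
have dlt b : differentiable (l b \o t) (atlas i p) by exact: differentiable_comp.
have dT b : differentiable ('D_w (T i j b)) (atlas i p).
  by apply: (smooth_on_differentiable _ Up); exact: smooth_on_derive.
rewrite (near_eq_derive u (near_open oU Up lE)).
rewrite derive_sumE => [|b]; last exact: differentiableM.
rewrite derive_local_coef_sum// -big_split; apply: eq_bigr => b _ /=.
rewrite (deriveM (diff_derivable (dT b)) (diff_derivable (dlt b))).
rewrite /= tE; congr (_ + _).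
rewrite (deriveE _ (dlt b)) (diff_comp dt (dl b)) /= -(deriveE _ (dl b)) tE.
have cE z : coord_family i p z j = 'd t (atlas i p) z by exact: coord_vector_change.
by rewrite !cE derive_transition_coord.
Qed.

(** The symmetric second-order terms in [derive_local_coef_change] cancel in the
    antisymmetric difference that defines [dform]. *)
Lemma dform_in_chart i p (v : 'I_2 -> tangent p) : chart_dom (atlas i) p ->
  @dform _ _ _ a p v = 'D_(v ord0 i) (local_coef a i (v ord_max i)) (atlas i p)
              - 'D_(v ord_max i) (local_coef a i (v ord0 i)) (atlas i p).
Proof.
move=> ip; have jp : chart_dom (atlas (chart_at p)) p.
  by rewrite /chart_at; case: cid.
rewrite !(derive_local_coef_change _ _ ip jp) !coord_vectorK//.
have sym b : 'D_(v ord0 i) ('D_(v ord_max i) (T i (chart_at p) b)) (atlas i p) =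
             'D_(v ord_max i) ('D_(v ord0 i) (T i (chart_at p) b)) (atlas i p).
  apply: (smooth_on_derive_comm _ _ _ (T_smooth i (chart_at p) b)).
    exact: chart_overlap_open.
  by exists p.
rewrite opprD addrACA -[LHS]addr0; congr (_ + _).
apply/esym/eqP; rewrite subr_eq0; apply/eqP.
by apply: eq_bigr => b _; rewrite (sym b).
Qed.

Lemma multilinear_dform p : multilinear (@dform _ _ _ a p).
Proof.
move=> i v c x y.
have jp : chart_dom (atlas (chart_at p)) p by rewrite /chart_at; case: cid.
rewrite !(dform_in_chart _ jp); set j := chart_at p in jp *.
have dD w : differentiable (local_coef a j w) (atlas j p).
  exact: local_coef_differentiable.
have lin1 w u u' : 'D_(c *: u + u') (local_coef a j w) (atlas j p) =
    c * 'D_u (local_coef a j w) (atlas j p) + 'D_u' (local_coef a j w) (atlas j p).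
  by rewrite !(deriveE _ (dD w)) linearP.
have lin2 w u u' : 'D_w (local_coef a j (c *: u + u')) (atlas j p) =
    c * 'D_w (local_coef a j u) (atlas j p) + 'D_w (local_coef a j u') (atlas j p).
  rewrite !(derive_local_coef_sum _ _ _ jp) mulr_sumr -big_split.
  by apply: eq_bigr => b _; rewrite !mxE mulrDl mulrA.
have [->|->] : i = ord0 \/ i = ord_max.
  by case: i => -[|[|//]] ?; [left|right]; apply/val_inj.
- rewrite /upd /= lin1 lin2; ring.
- rewrite /upd /= lin1 lin2; ring.
Qed.

End ExteriorDerivative.

Section SmoothForms.
Context (R : realType) (n : nat) (M : smooth_manifold R n).

(** Smoothness of all coefficients on constant coordinate fields, in the same
    form as for [one_form]. *)
Definition smooth_form k (w : Defs.form M k) : Prop :=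
  forall i (x : 'I_k -> 'rV[R]_n), smooth_on (chart_img (atlas i))
    (fun y => w (chart_inv (atlas i) y)
                (fun b => coord_vector i (chart_inv (atlas i) y) (x b)) : R^o).

Let img_open (i : atlas_index M) : open (chart_img (atlas i)).
Proof. exact: chart_img_open. Qed.

Lemma smooth_form_of (a : one_form M) : smooth_form (form_of a).
Proof. by move=> i x; exact: covector_smooth. Qed.

(** In a fixed chart, [dform_in_chart] expresses the coefficients through
    derivatives of those of [a]. *)
Lemma smooth_dform (a : one_form M) : smooth_form (dform a).
Proof.
move=> i x.
have s1 := smooth_on_derive (x ord0) (local_coef_smooth a i (x ord_max)).
have s2 := smooth_on_derive (x ord_max) (local_coef_smooth a i (x ord0)).
have s2N := smooth_onM (@img_open i) (smooth_on_cst (@img_open i) (-1 : R^o)) s2.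
apply: (smooth_on_eq (@img_open i) _ (fun k => Ck_onD (@img_open i) (s1 k) (s2N k))).
move=> y iy; have [ip yE] := chart_imgK iy.
by rewrite (dform_in_chart _ _ ip) !coord_vectorE// yE mulN1r.
Qed.

Lemma smooth_wedgef k l (w : Defs.form M k) (t : Defs.form M l) :
  smooth_form w -> smooth_form t -> smooth_form (w \wedge t).
Proof.
move=> sw st i x; apply: (smooth_onM (@img_open i)); first exact: smooth_on_cst.
apply: (smooth_on_sum (@img_open i)) => s.
apply: (smooth_onM (@img_open i)); last exact: (st i (fun b => x (s (rshift k b)))).
apply: (smooth_onM (@img_open i)); last exact: (sw i (fun b => x (s (lshift l b)))).
exact: smooth_on_cst.
Qed.

Lemma smooth_wedgef_pow k (w : Defs.form M k) m :
  smooth_form w -> smooth_form (wedgef_pow w m).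
Proof.
move=> sw; elim: m => [|m IHm]; first by move=> i x; exact: smooth_on_cst.
exact: smooth_wedgef sw IHm.
Qed.

End SmoothForms.

(** * Reeb vector fields *)

Lemma vector_field_eq (R : realType) n (M : smooth_manifold R n) (X Y : vector_field M) :
  (forall p, X p = Y p) -> X = Y.
Proof.
case: X Y => [X sX] [Y sY] /= XY.
have eXY : X = Y by apply: functional_extensionality_dep.
by case: _ / eXY sY => sY; congr VectorField; exact: Prop_irrelevance.
Qed.

Section ReebField.
Context (R : realType) (m : nat) (M : smooth_manifold R m.+1).
Variables (a : one_form M) (w : Defs.form M m).
Hypotheses (alt_w : forall p, alternating (@w p)) (ml_w : forall p, multilinear (@w p)).
Hypotheses (smooth_w : smooth_form w) (vol_neq0 : nowhere_zero (form_of a \wedge w)).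

Let basis (i : atlas_index M) (p : M) (b : 'I_m.+1) : tangent p :=
  coord_vector i p (delta_mx 0 b).

Definition reeb_at (i : atlas_index M) (p : M) : tangent p :=
  reeb_vector (basis i p) (a p) (@w p).

Lemma reeb_atP i p : chart_dom (atlas i) p ->
  a p (reeb_at i p) = 1 /\ kills (reeb_at i p) (@w p).
Proof.
move=> ip; have sp u : exists c : 'I_m.+1 -> R, u = \sum_b c b *: basis i p b.
  exact: coord_basis_span.
exact: (reeb_vectorP sp (@alt_w p) (@ml_w p) (vol_neq0 p)).
Qed.

Lemma reeb_at_unique i p u : chart_dom (atlas i) p ->
  a p u = 1 -> kills u (@w p) -> u = reeb_at i p.
Proof.
move=> ip; have sp v : exists c : 'I_m.+1 -> R, v = \sum_b c b *: basis i p b.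
  exact: coord_basis_span.
exact: (reeb_vector_unique sp (@alt_w p) (@ml_w p) (vol_neq0 p)).
Qed.

Lemma chart_atP (p : M) : chart_dom (atlas (chart_at p)) p.
Proof. by rewrite /chart_at; case: cid. Qed.

(** On the image of the chart [i], uniqueness allows [reeb_at] to be computed in
    that chart rather than in the chart chosen at each point. *)
Lemma reeb_smooth (i : atlas_index M) :
  smooth_on (chart_img (atlas i))
    (fun y => reeb_at (chart_at (chart_inv (atlas i) y)) (chart_inv (atlas i) y) i).
Proof.
have oI : open (chart_img (atlas i)) by exact: chart_img_open.
pose q y := chart_inv (atlas i) y.
pose d (b : 'I_m.+1) : 'rV[R]_m.+1 := delta_mx 0 b.
pose c (b : 'I_m.+1) y : R^o := @w (q y) (fun k : 'I_m => basis i (q y) (lift b k)) *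
  (pivot (basis i (q y)) (a (q y)) (@w (q y)) b)^-1.
pose g y : R^o := \sum_b c b y * local_coef a i (d b) y.
have span y : chart_img (atlas i) y -> forall u : tangent (q y),
    exists c : 'I_m.+1 -> R, u = \sum_b c b *: basis i (q y) b.
  by move=> /chart_imgK[iq _] u; exact: coord_basis_span.
have gE y : g y = a (q y) (kernel_vector (basis i (q y)) (a (q y)) (@w (q y))).
  by rewrite linear_sum; apply: eq_bigr => b _; rewrite linearZ.
have g0 y : chart_img (atlas i) y -> g y != 0.
  move=> iy; rewrite gE.
  exact: (kernel_vector_neq0 (span y iy) (@alt_w _) (@ml_w _) (vol_neq0 _)).
have pivot_smooth b : smooth_on (chart_img (atlas i))
    (fun y => pivot (basis i (q y)) (a (q y)) (@w (q y)) b : R^o).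
  have sv : smooth_form (form_of a \wedge w).
    by apply: smooth_wedgef => //; exact: smooth_form_of.
  apply: (smooth_on_eq oI _ (sv i (cons_vec (d b) (fun k => d (lift b k))))) => y _.
  rewrite /pivot /wedgef; congr wedge; apply/funext => k.
  by rewrite /cons_vec; case: (unlift ord0 k).
have c_smooth b : smooth_on (chart_img (atlas i)) (c b).
  apply: (smooth_onM oI); first exact: (smooth_w i (fun k => d (lift b k))).
  apply: (smooth_onV oI _ (pivot_smooth b)) => y iy.
  exact: (pivot_neq0 (span y iy) (@ml_w _) (vol_neq0 _)).
have g_smooth : smooth_on (chart_img (atlas i)) g.
  apply: (smooth_on_sum oI) => b; apply: (smooth_onM oI); first exact: c_smooth.
  exact: local_coef_smooth.
have s : smooth_on (chart_img (atlas i)) (fun y => \sum_b ((g y)^-1 * c b y) *: d b).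
  apply: (smooth_on_sum oI) => b; apply: (smooth_on_scale oI).
  by apply: (smooth_onM oI); [exact: (smooth_onV oI g0)|exact: c_smooth].
apply: (smooth_on_eq oI _ s) => y iy; have [iq _] := chart_imgK iy.
(* The solution found in the chart chosen at [q y] is the one found in [i]. *)
have [ar wr] := reeb_atP (chart_atP (q y)).
rewrite (reeb_at_unique iq ar wr) /reeb_at /reeb_vector tangentZ -gE tangent_sum.
rewrite scaler_sumr; apply: eq_bigr => b _.
by rewrite tangentZ coord_vectorE// scalerA.
Qed.

Definition reeb_field : vector_field M :=
  @VectorField _ _ _ (fun p => reeb_at (chart_at p) p) reeb_smooth.

Lemma exists_unique_reeb_field :
  exists! X : vector_field M, (forall p, a p (X p) = 1) /\ vanishes (interiorf X w).
Proof.
exists reeb_field; split.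
  split=> p; first exact: (reeb_atP (chart_atP p)).1.
  by apply/(kills_interior _ (@alt_w p)); exact: (reeb_atP (chart_atP p)).2.
move=> Y [aY wY]; apply: vector_field_eq => p /=; symmetry.
apply: (reeb_at_unique (chart_atP p) (aY p)).
by apply/(kills_interior _ (@alt_w p)) => v; exact: wY.
Qed.

End ReebField.

(** The degree of a wedge product need not be syntactically the predecessor of
    the dimension, hence the equation between [n] and [m.+1]. *)
Lemma exists_unique_reeb (R : realType) (n m : nat) (M : smooth_manifold R n)
    (a : one_form M) (w : Defs.form M m) : n = m.+1 ->
  (forall p, alternating (@w p)) -> (forall p, multilinear (@w p)) ->
  smooth_form w -> nowhere_zero (form_of a \wedge w) ->
  exists! X : vector_field M, (forall p, a p (X p) = 1) /\ vanishes (interiorf X w).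
Proof. by move=> e; subst n; exact: exists_unique_reeb_field. Qed.

Theorem theorem2p2 (R : realType) (h k : nat)
    (M : smooth_manifold R (2 * h + 2 * k + 2)) (alpha eta : one_form M)
    (Hpair : contact_pair h k alpha eta) :
  (exists! Xalpha : vector_field M,
     (forall p : M, alpha p (Xalpha p) = 1) /\
     vanishes (interiorf Xalpha
       (wedgef_pow (dform alpha) h \wedge form_of eta
        \wedge wedgef_pow (dform eta) k))) /\
  (exists! Xeta : vector_field M,
     (forall p : M, eta p (Xeta p) = 1) /\
     vanishes (interiorf Xeta
       (form_of alpha \wedge wedgef_pow (dform alpha) h
        \wedge wedgef_pow (dform eta) k))).
Proof.
have [_ _ vol] := Hpair.
have ml_pow (b : one_form M) l p : multilinear (wedgef_pow (dform b) l p).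
  by apply: multilinear_wedge_pow; exact: multilinear_dform.
have ml_one (b : one_form M) p : multilinear (@form_of _ _ _ b p).
  exact: multilinear_scalar.
have s_pow (b : one_form M) l : smooth_form (wedgef_pow (dform b) l).
  by apply: smooth_wedgef_pow; exact: smooth_dform.
split; apply: exists_unique_reeb.
- lia.
- by move=> p; exact: alternating_wedge.
- by move=> p; do 2 apply: multilinear_wedge => //.
- by do 2 apply: smooth_wedgef => //; exact: smooth_form_of.
- by move=> p; apply: nonzero_wedgeA; exact: vol.
- lia.
- by move=> p; exact: alternating_wedge.
- by move=> p; do 2 apply: multilinear_wedge => //.
- by do 2 apply: smooth_wedgef => //; exact: smooth_form_of.
- by move=> p; apply: nonzero_wedgeCA; exact: vol.
Qed.
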